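(* Let $E$ and $F$ be finite essential graphs with adjacency matrices $A_E$ and $A_F$ such that $A_E$ and $A_F$ are shift equivalent. Then $E$ is a graph with disjoint cycles if and only if $F$ is a graph with disjoint cycles. In this case, there exists an order-preserving bijection $\phi:\mathcal{C}_E\to\mathcal{C}_F$ such that $|c|=|\phi(c)|$ for all $c\in\mathcal{C}_E$.
   Context: A graph $E=(E^0,E^1,r,s)$ consists of a vertex set $E^0$, an edge set $E^1$ and source and range maps $s,r:E^1\to E^0$. It is finite if $E^0$ and $E^1$ are finite. A sink is a vertex emitting no edge and a source is a vertex receiving no edge; a finite graph is essential if it has neither sources nor sinks. The adjacency matrix $A_E$ is the $E^0\times E^0$ matrix with $A_E(v,w)=|s^{-1}(v)\cap r^{-1}(w)|$. Two square nonnegative integer matrices $A,B$ are shift equivalent if there exist $l\ge 1$ and nonnegative integer matrices $R,S$ with $A^l=RS$, $B^l=SR$, $AR=RB$ and $SA=BS$. A path is a string of edges $p=e_1\cdots e_n$ with $r(e_i)=s(e_{i+1})$, of length $|p|=n$ (vertices are paths of length $0$), with $s(p)=s(e_1)$, $r(p)=r(e_n)$. A path $p=e_1\cdots e_n$ of positive length is a cycle based at $v$ if $s(p)=r(p)=v$ and $s(e_1),\dots,s(e_n)$ are distinct. $E$ is a graph with disjoint cycles if every vertex is the base of at most one cycle. $\mathcal{C}_E$ denotes the set of all distinct cycles of $E$, where cycles differing only by the choice of base vertex (cyclic rotation) are identified; $c^0$ is the set of vertices on $c$. For $c,c'\in\mathcal{C}_E$, $c\le c'$ means that there is a path starting at some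 vertex of $c'$ and ending at some vertex of $c$. For a graph with disjoint cycles, $(\mathcal{C}_E,\le)$ is a partially ordered set. *)

(* Defs.v *)
From HB Require Import structures.
From mathcomp Require Import all_boot all_order all_algebra.
From mathcomp Require Import generic_quotient.

Set Implicit Arguments.
Unset Strict Implicit.
Unset Printing Implicit Defensive.

Import GRing.Theory.
Local Open Scope ring_scope.

Record fin_graph := FinGraph {
  vert : finType;
  edge : finType;
  src : edge -> vert;
  rng : edge -> vert
}.

Definition essential (E : fin_graph) : Prop :=
  forall v : vert E, (exists e : edge E, src e = v) /\ (exists e : edge E, rng e = v).

(* The rows and columns are numbered along [enum (vert E)]. *)
Definition adjacency (E : fin_graph) : 'M[nat]_#|vert E| :=
  \matrix_(i, j) #|[set e : edge E | (src e == enum_val i) && (rng e == enum_val j)]|.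

Definition shift_equivalent (m n : nat) (A : 'M[nat]_m) (B : 'M[nat]_n) : Prop :=
  exists (l : nat) (R : 'M[nat]_(m, n)) (S : 'M[nat]_(n, m)),
    [/\ (0 < l)%N,
        A ^+ l = R *m S /\ B ^+ l = S *m R,
        A *m R = R *m B &
        S *m A = B *m S].

Section Cycles.
Variable E : fin_graph.

(* The empty list is the path of length 0 at [v], when [w = v]. *)
Fixpoint path_from_to (v : vert E) (p : seq (edge E)) (w : vert E) : bool :=
  if p is e :: p' then (src e == v) && path_from_to (rng e) p' w else v == w.

Definition cycle_at (v : vert E) (p : seq (edge E)) : bool :=
  [&& (0 < size p)%N, path_from_to v p v & uniq (map (@src E) p)].

Definition disjoint_cycles : Prop :=
  forall (v : vert E) (p q : seq (edge E)), cycle_at v p -> cycle_at v q -> p = q.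

Definition based_cycle := {p : seq (edge E) | [exists v, cycle_at v p]}.

Definition rot_equiv (p q : based_cycle) : bool :=
  [exists i : 'I_(size (val p)).+1, rot i (val p) == val q].

Lemma rot_equivP (p q : based_cycle) :
  reflect (exists2 i, (i <= size (val p))%N & rot i (val p) = val q) (rot_equiv p q).
Proof.
apply: (iffP existsP) => [[i /eqP <-]|[i lei <-]]; first by exists i; rewrite // -ltnS.
by exists (Ordinal (lei : (i < (size (val p)).+1)%N)).
Qed.

Lemma rot_equiv_refl : reflexive rot_equiv.
Proof. by move=> p; apply/rot_equivP; exists 0; rewrite ?rot0. Qed.

Lemma rot_equiv_sym : symmetric rot_equiv.
Proof.
suff H p q : rot_equiv p q -> rot_equiv q p by move=> p q; apply/idP/idP; apply: H.
case/rot_equivP=> i lei Dq; apply/rot_equivP.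
exists (size (val q) - i)%N; first exact: leq_subr.
by rewrite -/(rotr i (val q)) -Dq rotK.
Qed.

Lemma rot_equiv_trans : transitive rot_equiv.
Proof.
move=> q p r /rot_equivP[i lei Dq] /rot_equivP[j lej Dr]; apply/rot_equivP.
have szq : size (val q) = size (val p) by rewrite -Dq size_rot.
rewrite szq in lej; move: Dr; rewrite -Dq rot_add_mod // => <-.
case: ifP => [le_ij|_]; first by exists (j + i)%N; rewrite // addnC.
by eexists; last by []; rewrite leq_subLR leq_add.
Qed.

Canonical rot_equiv_rel :=
  EquivRel rot_equiv rot_equiv_refl rot_equiv_sym rot_equiv_trans.

Definition cycle_class := {eq_quot rot_equiv_rel}%qT.

Definition cycle_length (c : cycle_class) : nat := size (val (repr c)).

Definition cycle_verts (c : cycle_class) : {set vert E} :=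
  [set v in map (@src E) (val (repr c))].

Definition cycle_le (c c' : cycle_class) : Prop :=
  exists (v w : vert E) (p : seq (edge E)),
    [/\ v \in cycle_verts c', w \in cycle_verts c & path_from_to v p w].

(* Length and vertex set do not depend on the representative. *)
Lemma cycle_length_pi (p : based_cycle) :
  cycle_length (\pi_cycle_class p)%qT = size (val p).
Proof.
rewrite /cycle_length; case: piP => q /eqmodP/rot_equivP[i _ <-].
by rewrite size_rot.
Qed.

Lemma cycle_verts_pi (p : based_cycle) :
  cycle_verts (\pi_cycle_class p)%qT = [set v in map (@src E) (val p)].
Proof.
rewrite /cycle_verts; case: piP => q /eqmodP/rot_equivP[i _ <-].
by apply/setP=> v; rewrite !inE map_rot mem_rot.
Qed.

End Cycles.

(* Main.v *)
(** The entries of [A^n] count the paths of length [n]. Hence [E] has disjoint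
    cycles iff the diagonals of all [A^n] are bounded by 1, iff the traces
    [tr A^n] are bounded; and [tr A^n = tr B^n] for [n >= l].

    View the nonzero entries of [R] and [S] as edges from [E] to [F] and from [F]
    to [E]. Since [R B^n S = A^(n+l)] and [S A^n R = B^(n+l)], this does not
    change reachability inside [E] or [F], and every closed path of length at
    least [l] in one graph yields one of the same length in the other, in the same
    strongly connected component. For disjoint cycles, each nontrivial component
    thus contains one cycle of [E] and one of [F]; this matching preserves the
    order, and the two cycles have equal lengths because each length divides the
    multiples [l n] and [(l+1) n] of the other. *)

Require Import Defs.
From mathcomp Require Import all_boot all_order all_algebra.
From mathcomp Require Import generic_quotient.

Set Implicit Arguments.
Unset Strict Implicit.
Unset Printing Implicit Defensive.

Import GRing.Theory.

(** * Paths, reachability and cycles in one graph *)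

Section Paths.
Variable E : fin_graph.
Implicit Types (u v w x : vert E) (e : edge E) (p q : seq (edge E)).

Lemma path_from_to_cat v p q w :
  path_from_to v (p ++ q) w =
  [exists u, path_from_to v p u && path_from_to u q w].
Proof.
elim: p v => [|e p IHp] v /=.
  apply/idP/existsP => [pq|[u /andP[/eqP-> //]]].
  by exists v; rewrite eqxx.
rewrite IHp; apply/andP/existsP => [[-> /existsP[u pq]]|[u /andP[/andP[-> pu] qu]]].
  by exists u.
by split=> //; apply/existsP; exists u; rewrite pu.
Qed.

Lemma path_from_to_trans v p u q w :
  path_from_to v p u -> path_from_to u q w -> path_from_to v (p ++ q) w.
Proof.
by move=> pu qw; rewrite path_from_to_cat; apply/existsP; exists u; rewrite pu.
Qed.

Lemma path_from_to_split v p q w :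
  path_from_to v (p ++ q) w ->
  exists2 u, path_from_to v p u & path_from_to u q w.
Proof. by rewrite path_from_to_cat => /existsP[u /andP[]]; exists u. Qed.

Lemma path_from_to_end v p u w :
  path_from_to v p u -> path_from_to v p w -> u = w.
Proof.
elim: p v => [|e p IHp] v /=; first by move=> /eqP<- /eqP.
by move=> /andP[_ pu] /andP[_]; apply: IHp pu.
Qed.

Lemma path_from_to_flatten v k p :
  path_from_to v p v -> path_from_to v (flatten (nseq k p)) v.
Proof.
by move=> pv; elim: k => [|k IHk] /=; [apply: eqxx | apply: path_from_to_trans IHk].
Qed.

Definition adjacent v w := [exists e : edge E, (src e == v) && (rng e == w)].
Definition reach := connect adjacent.

Lemma lift_vertex_path v s :
  path adjacent v s ->
  exists2 p, path_from_to v p (last v s) & map (@src E) p = belast v s.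
Proof.
elim: s v => [|w s IHs] v /=; first by exists [::]; rewrite //= eqxx.
case/andP=> /existsP[e /andP[/eqP<- /eqP<-]] /IHs[p pw Dp].
by exists (e :: p); rewrite /= ?eqxx ?Dp.
Qed.

Lemma reachP v w : reflect (exists p, path_from_to v p w) (reach v w).
Proof.
apply: (iffP connectP) => [[s /lift_vertex_path[p pw _] ->]|[p]].
  by exists p.
elim: p v => [|e p IHp] v /=; first by move/eqP->; exists [::].
case/andP=> /eqP Dv /IHp[s ps Dw]; exists (rng e :: s) => //=.
by rewrite ps andbT; apply/existsP; exists e; rewrite Dv !eqxx.
Qed.

(** Shortening the vertex walk back to [src e] makes its vertices distinct. The sources along
    [e :: p] are a rotation of these vertices, so they are distinct too. *)
Lemma cycle_of_edge e :
  reach (rng e) (src e) -> exists p, cycle_at (src e) (e :: p).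
Proof.
case/connectP=> s0 /shortenP[s ps Us _] Dv.
have [p pv Dp] := lift_vertex_path ps; exists p.
rewrite /cycle_at /= eqxx Dp {1}Dv pv /=.
by rewrite {1}Dv -rcons_uniq -lastI.
Qed.

(** An earlier return to [v] would make [v] the source of both the first edge and the edge at
    position [k]. *)
Lemma cycle_prefix v p k :
  cycle_at v p -> 0 < k <= size p -> path_from_to v (take k p) v -> k = size p.
Proof.
case/and3P=> p_gt0 pv Up /andP[k_gt0 lekp] pk; apply/eqP.
rewrite eqn_leq lekp leqNgt; apply/negP=> ltkp.
have := pv; rewrite -(cat_take_drop k p) => /path_from_to_split[u pu].
rewrite -(path_from_to_end pk pu); case Ddrop: (drop k p) => [|e q].
  by have := size_drop k p; rewrite Ddrop => /eqP; rewrite eq_sym subn_eq0 leqNgt ltkp.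
case/andP=> /eqP De _; have := Up; rewrite -(cat_take_drop k p) map_cat cat_uniq Ddrop /=.
rewrite De; case: (p) pk k_gt0 lekp => [|e' p']; first by case: (k).
by case: (k) => //= k' /andP[/eqP-> _]; rewrite inE eqxx !andbF.
Qed.

Lemma reach_edge e : reach (src e) (rng e).
Proof. by apply/connect1/existsP; exists e; rewrite !eqxx. Qed.

Lemma cycle_eq_take v p q :
  cycle_at v p -> cycle_at v q -> size p <= size q -> take (size p) q = p -> p = q.
Proof.
move=> cp cq lepq Dp; have [p_gt0 pv _] := and3P cp.
have := cycle_prefix cq (k := size p); rewrite p_gt0 lepq Dp => /(_ isT pv) Dsz.
by rewrite -Dp Dsz take_size.
Qed.

Lemma rot_cycle_at v p w :
  cycle_at v p -> w \in map (@src E) p -> exists2 i, i <= size p & cycle_at w (rot i p).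
Proof.
case/and3P=> p_gt0 pv Up /(nthP w)[i]; rewrite size_map => ltip Dw.
exists i; first exact: ltnW.
rewrite /cycle_at size_rot p_gt0 map_rot rot_uniq Up andbT /=.
have := pv; rewrite -{1}(cat_take_drop i p) => /path_from_to_split[u pu du].
suff -> : w = u by rewrite /rot; apply: path_from_to_trans pu.
move: Dw du; rewrite -[i in nth _ _ i]addn0 -nth_drop -map_drop.
case: (drop i p) (size_drop i p) => [/eqP|e q _ /= <- /andP[/eqP->] //].
by rewrite eq_sym subn_eq0 leqNgt ltip.
Qed.

Lemma disjoint_of_unique_closed_path :
  (forall n v p q, size p = n -> size q = n ->
     path_from_to v p v -> path_from_to v q v -> p = q) ->
  disjoint_cycles E.
Proof.
move=> Hu v p q cp cq.
have [p_gt0 pv _] := and3P cp; have [q_gt0 qv _] := and3P cq.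
have szf k (s : seq (edge E)) : size (flatten (nseq k s)) = k * size s.
  by rewrite size_flatten /shape map_nseq sumn_nseq mulnC.
(* Repeating each cycle as often as the other has edges gives closed paths of the common length
   [size p * size q]. Hence the shorter cycle is a prefix of the longer one. *)
have Dpq : flatten (nseq (size q) p) = flatten (nseq (size p) q).
  by apply: Hu (path_from_to_flatten _ pv) (path_from_to_flatten _ qv) => //;
     rewrite szf // mulnC.
have take_flat k (s : seq (edge E)) j : 0 < k -> j <= size s ->
    take j (flatten (nseq k s)) = take j s.
  by case: k => //= k _ lejs; apply: takel_cat.
case: (leqP (size p) (size q)) => [le_pq|/ltnW le_qp].
  apply: (cycle_eq_take cp cq) => //.
  by rewrite -(take_flat (size p)) // -Dpq take_flat ?take_size.
apply/esym; apply: (cycle_eq_take cq cp) => //.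
by rewrite -(take_flat (size q)) // Dpq take_flat ?take_size.
Qed.

(** * Rigidity of closed paths when cycles are disjoint *)

Section Disjoint.
Hypothesis disjE : disjoint_cycles E.

(** Each of the two edges opens a cycle at their common source, and that cycle is unique. *)
Lemma unique_exit e e' :
  src e = src e' -> reach (rng e) (src e) -> reach (rng e') (src e') -> e = e'.
Proof.
by move=> Dv /cycle_of_edge[p cp] /cycle_of_edge[q]; rewrite -Dv => /(disjE cp)[].
Qed.

(** Since both ends lead back to [v], every edge met on the way lies on a closed path, so
    [unique_exit] forces it. The ends are not assumed equal, which allows comparing a closed path
    with a prefix of another one. *)
Lemma unique_path v p q u w :
    size p = size q -> path_from_to v p u -> path_from_to v q w ->
  reach u v -> reach w v -> p = q.
Proof.
elim: p v q => [|e p IHp] v [|e' q] //= [Dsz] /andP[/eqP De pu] /andP[/eqP De' qw] uv wv.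
have eu : reach (rng e) u by apply/reachP; exists p.
have ew : reach (rng e') w by apply/reachP; exists q.
have Dee' : e = e'.
  apply: unique_exit; rewrite ?De ?De' //; first exact: connect_trans uv.
  exact: connect_trans wv.
rewrite -Dee' in qw *; congr (_ :: _).
have ve : reach v (rng e) by rewrite -De reach_edge.
by apply: IHp pu qw _ _ => //; apply: connect_trans ve.
Qed.

(** Euclidean division: copies of [p] are stripped from the front of [q]. A nonempty remainder
    shorter than [p] would be a prefix of [p] returning to [v], against [cycle_prefix]. *)
Lemma cycle_dvd_closed v p q :
  cycle_at v p -> path_from_to v q v -> size p %| size q.
Proof.
move=> cp; have [p_gt0 pv _] := and3P cp.
have [n] := ubnP (size q); elim: n q => // n IHn q ltqn qv.
have rvv : reach v v by apply: connect0.
have [lepq|ltqp] := leqP (size p) (size q); last first.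
  case: (posnP (size q)) => [-> //|q_gt0].
  have [u pu /= uv] : exists2 u, path_from_to v (take (size q) p) u & reach u v.
    have := pv; rewrite -{1}(cat_take_drop (size q) p) => /path_from_to_split[u pu du].
    by exists u => //; apply/reachP; exists (drop (size q) p).
  have Dq : take (size q) p = q.
    by apply: unique_path pu qv uv rvv; rewrite size_takel // ltnW.
  have := cycle_prefix cp (k := size q); rewrite q_gt0 ltnW // Dq => /(_ isT qv) Dsz.
  by rewrite Dsz ltnn in ltqp.
have := qv; rewrite -{1}(cat_take_drop (size p) q) => /path_from_to_split[u qu du].
have Dp : take (size p) q = p.
  apply: unique_path qu pv _ rvv; first by rewrite size_takel.
  by apply/reachP; exists (drop (size p) q).
rewrite Dp in qu; rewrite -(path_from_to_end pv qu) in du.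
rewrite -(cat_take_drop (size p) q) Dp size_cat dvdn_addr // IHn //.
rewrite size_drop; rewrite ltnS in ltqn; apply: leq_trans ltqn.
by rewrite ltn_subrL p_gt0 (leq_trans p_gt0).
Qed.

End Disjoint.

(** * Cycle classes and their order *)

Lemma cycle_class_closed (c : cycle_class E) v :
  v \in cycle_verts c ->
  exists p, [/\ cycle_at v p, size p = cycle_length c & map (@src E) p =i cycle_verts c].
Proof.
rewrite inE /cycle_length /cycle_verts.
case: (repr c) => /= p /existsP[u cp] /(rot_cycle_at cp)[i _ ci].
by exists (rot i p); rewrite size_rot map_rot; split=> // x; rewrite mem_rot inE.
Qed.

Lemma cycle_class_vert (c : cycle_class E) : exists v, v \in cycle_verts c.
Proof.
rewrite /cycle_verts; case: (repr c) => /= -[|e p] /existsP[u /and3P[//= _ _ _]].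
by exists (src e); rewrite !inE eqxx.
Qed.

Lemma closed_path_class v p :
  0 < size p -> path_from_to v p v -> exists c : cycle_class E, v \in cycle_verts c.
Proof.
case: p => //= e p _ /andP[/eqP<- pv].
have [|q cq] := @cycle_of_edge e; first by apply/reachP; exists p.
have hq : [exists v, cycle_at v (e :: q)] by apply/existsP; exists (src e).
exists (\pi_(cycle_class E) (exist _ (e :: q) hq : based_cycle E))%qT.
by rewrite cycle_verts_pi !inE eqxx.
Qed.

Lemma path_src_reach v p w x :
  path_from_to v p w -> x \in map (@src E) p -> reach v x.
Proof.
elim: p v => //= e p IHp v /andP[/eqP<- pw]; rewrite inE => /predU1P[->|].
  exact: connect0.
by move=> px; apply: connect_trans (reach_edge e) (IHp _ pw px).
Qed.

Lemma cycle_class_reach (c : cycle_class E) v w :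
  v \in cycle_verts c -> w \in cycle_verts c -> reach v w.
Proof.
rewrite !inE; case: (repr c) => /= p /existsP[u cp] /(rot_cycle_at cp)[i _].
by case/and3P=> _ ci _ pw; apply: path_src_reach ci _; rewrite map_rot mem_rot.
Qed.

(** Rotated to start at [v], both representatives are the unique cycle there. *)
Lemma cycle_class_eq (c c' : cycle_class E) v :
  disjoint_cycles E -> v \in cycle_verts c -> v \in cycle_verts c' -> c = c'.
Proof.
move=> disjE; rewrite !inE -[in RHS](reprK c') -[in LHS](reprK c).
case: (repr c) (repr c') => /= p hp [q hq] /= pv qv; apply/eqmodP.
have [[u cp] [w cq]] := (existsP hp, existsP hq).
have [i lei ci] := rot_cycle_at cp pv; have [j lej cj] := rot_cycle_at cq qv.
have hr : [exists v, cycle_at v (rot i p)] by apply/existsP; exists v.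
have pr : rot_equiv (exist _ p hp) (exist _ (rot i p) hr : based_cycle E).
  by apply/rot_equivP; exists i.
apply: rot_equiv_trans pr _; rewrite rot_equiv_sym; apply/rot_equivP.
by exists j => //=; apply: disjE cj ci.
Qed.

Lemma cycle_class_next (c : cycle_class E) e :
    disjoint_cycles E -> src e \in cycle_verts c -> reach (rng e) (src e) ->
  rng e \in cycle_verts c.
Proof.
move=> disjE /cycle_class_closed[p [cp _ Dp]] /cycle_of_edge[q cq].
move: cp; rewrite -Dp => /disjE/(_ cq)->.
case/and3P: cq => _ /= /andP[_]; case: q => [/eqP->|e' q /andP[/eqP<- _]] _.
  exact: mem_head.
by rewrite !inE eqxx orbT.
Qed.

(** A path from [v] to [w] never leaves [c]: each of its edges can be closed up, so
    [cycle_class_next] keeps its range on [c]. *)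
Lemma reach_cycle_class (c c' : cycle_class E) v w :
    disjoint_cycles E -> v \in cycle_verts c -> w \in cycle_verts c' ->
  reach v w -> reach w v -> c = c'.
Proof.
move=> disjE cv cw /reachP[p]; elim: p v cv => [|e p IHp] v cv /=.
  by move=> /eqP Dw _; apply: cycle_class_eq disjE cv _; rewrite Dw.
case/andP=> /eqP Dv pw wv; have ew : reach (rng e) w by apply/reachP; exists p.
have ve : reach v (rng e) by rewrite -Dv reach_edge.
apply: IHp pw (connect_trans wv ve).
by apply: cycle_class_next; rewrite ?Dv //; apply: connect_trans ew wv.
Qed.

(** The ends of a path can be slid along the two cycles, so any choice of vertices tests the
    order. *)
Lemma cycle_leP (c c' : cycle_class E) v w :
  v \in cycle_verts c -> w \in cycle_verts c' -> cycle_le c c' <-> reach w v.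
Proof.
move=> cv cw; split=> [[w' [v' [p [cw' cv' p_w'v']]]]|/reachP[p p_wv]].
  apply: connect_trans (cycle_class_reach cw cw') _.
  by apply: connect_trans (cycle_class_reach cv' cv); apply/reachP; exists p.
by exists w, v, p.
Qed.

(** * Powers of the adjacency matrix as path counts *)

Lemma adjacency_expE n i j :
  (adjacency E ^+ n)%R i j =
  #|[set t : n.-tuple (edge E) | path_from_to (enum_val i) t (enum_val j)]|.
Proof.
elim: n i j => [|n IHn] i j.
  rewrite expr0 mxE -(inj_eq enum_val_inj).
  have [Dij|neq_ij] := eqVneq (enum_val i) (enum_val j).
    rewrite (_ : [set t | _] = [set [tuple]]) ?cards1 //.
    by apply/setP=> t; rewrite !inE tuple0 Dij /= !eqxx.
  rewrite (_ : [set t | _] = set0) ?cards0 //.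
  by apply/setP=> t; rewrite !inE tuple0 /= (negbTE neq_ij).
rewrite exprS -mulmxE mxE -sum1dep_card.
(* Split a path into its first edge and the rest, then group by the range of the first edge: this
   range is the summation index of the matrix product. *)
rewrite (reindex (fun et : edge E * n.-tuple (edge E) => [tuple of et.1 :: et.2])) /=; last first.
  exists (fun t => (thead t, [tuple of behead t])) => [[e t] _|t _] /=.
    by rewrite theadE; congr (_, _); apply: val_inj.
  by rewrite -tuple_eta.
rewrite -(pair_big_dep (fun e => src e == enum_val i)
  (fun e (t : n.-tuple (edge E)) => path_from_to (rng e) t (enum_val j)) (fun _ _ => 1)) /=.
rewrite (partition_big (fun e => enum_rank (rng e)) xpredT) //=; apply: eq_bigr => k _.
rewrite IHn mxE -sum1dep_card big_distrl /=.
apply: eq_big => [e|e /andP[_ /eqP Dk]].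
  by rewrite -(inj_eq enum_val_inj) enum_rankK.
by rewrite -sum1dep_card Dk; apply: mul1n.
Qed.

Lemma adjacency_exp_gt0 n i j :
  reflect (exists2 p, size p = n & path_from_to (enum_val i) p (enum_val j))
          (0 < (adjacency E ^+ n)%R i j).
Proof.
rewrite adjacency_expE; apply: (iffP card_gt0P) => [[t]|[p Dn pij]].
  by rewrite inE => tij; exists t; rewrite ?size_tuple.
by move/eqP: Dn => Dn; exists (Tuple Dn); rewrite inE.
Qed.

Lemma adjacency_reachP v w :
  reflect (exists n, 0 < (adjacency E ^+ n)%R (enum_rank v) (enum_rank w)) (reach v w).
Proof.
apply: (iffP (reachP v w)) => [[p pvw]|[n /adjacency_exp_gt0[p _]]].
  by exists (size p); apply/adjacency_exp_gt0; exists p; rewrite ?enum_rankK.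
by rewrite !enum_rankK; exists p.
Qed.

Lemma disjoint_diag_le1 :
  disjoint_cycles E <-> (forall n i, (adjacency E ^+ n)%R i i <= 1).
Proof.
split=> [disjE n i|diag1].
  rewrite adjacency_expE; apply/card_le1_eqP => t t'; rewrite !inE => ti t'i.
  apply: val_inj; apply: (unique_path disjE _ t'i ti); rewrite ?size_tuple //.
    exact: connect0.
  exact: connect0.
apply: disjoint_of_unique_closed_path => n v p q /eqP Dp /eqP Dq pv qv.
have := diag1 n (enum_rank v); rewrite adjacency_expE => /card_le1_eqP/(_ (Tuple Dp) (Tuple Dq)).
by rewrite !inE !enum_rankK => /(_ pv qv)[].
Qed.

End Paths.

(** * Matrices over the natural numbers *)

Section NatMatrix.
Local Open Scope ring_scope.

Lemma mulmx_gt0P (m n p : nat) (A : 'M[nat]_(m, n)) (B : 'M[nat]_(n, p)) i k :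
  reflect (exists2 j, (0 < A i j)%N & (0 < B j k)%N) (0 < (A *m B) i k)%N.
Proof.
have posM j : (0 < (A i j * B j k)%R)%N = (0 < A i j)%N && (0 < B j k)%N by apply: muln_gt0.
rewrite mxE lt0n sum_nat_eq0 negb_forall; apply: (iffP existsP) => [[j]|[j Aij Bjk]].
  by rewrite /= -lt0n posM => /andP[]; exists j.
by exists j; rewrite /= -lt0n posM Aij.
Qed.

Lemma mulmx_exp_comm (m n : nat) (A : 'M[nat]_m) (B : 'M[nat]_n) (R : 'M[nat]_(m, n)) k :
  A *m R = R *m B -> A ^+ k *m R = R *m B ^+ k.
Proof.
move=> AR; elim: k => [|k IHk]; first by rewrite !expr0 mul1mx mulmx1.
by rewrite !exprS -!mulmxE -mulmxA IHk !mulmxA AR.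
Qed.

Lemma mulmx_diag_ge (n : nat) (A B : 'M[nat]_n) i :
  (A i i * B i i <= (A *m B) i i)%N.
Proof. by rewrite mxE (bigD1 i) //=; apply: leq_addr. Qed.

(** A diagonal entry of [A ^+ k] that is at least 2 grows at least like [2 ^ m] in [A ^+ (k * m)],
    and the trace dominates it. *)
Lemma diag_le1_of_bounded_trace (n : nat) (A : 'M[nat]_n) l b :
    (forall k, (l <= k)%N -> (\tr (A ^+ k) <= b)%N) ->
  forall k i, ((A ^+ k) i i <= 1)%N.
Proof.
move=> trA k i; rewrite leqNgt; apply/negP=> gt1.
have k_gt0 : (0 < k)%N by case: k gt1 => //; rewrite expr0 mxE eqxx.
have grow m : (2 ^ m <= (A ^+ (k * m)) i i)%N.
  elim: m => [|m IHm]; first by rewrite muln0 expr0 mxE eqxx.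
  rewrite mulnS exprD -mulmxE expnS; apply: leq_trans (mulmx_diag_ge _ _ _).
  exact: leq_mul.
(* The choice [m = l + b] makes the exponent at least [l] and [2 ^ m] larger than [b]. *)
have le_l : (l <= k * (l + b))%N by apply: leq_trans (leq_addr b l) _; rewrite leq_pmull.
have := trA _ le_l; rewrite leqNgt => /negP; apply.
apply: (@leq_trans (2 ^ (l + b))%N).
  exact: leq_ltn_trans (leq_addl l b) (ltn_expl _ _).
apply: leq_trans (grow _) _.
by rewrite /mxtrace (bigD1 i) //=; apply: leq_addr.
Qed.

End NatMatrix.

(** * Crossing from one graph to the other *)

Section Crossing.
Variables (E F : fin_graph) (R : 'M[nat]_(#|vert E|, #|vert F|)).

(** All walking happens before the crossing; steps after it can be moved in front by [A R = R B], as
    [crosses_reach] shows. *)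
Definition crosses (v : vert E) (w : vert F) :=
  [exists u, reach v u && (0 < R (enum_rank u) (enum_rank w))].

Lemma crossesP v w :
  reflect (exists n, 0 < (adjacency E ^+ n *m R)%R (enum_rank v) (enum_rank w))
          (crosses v w).
Proof.
apply: (iffP existsP) => [[u /andP[/adjacency_reachP[n Anvu] Ruw]]|[n]].
  by exists n; apply/mulmx_gt0P; exists (enum_rank u).
case/mulmx_gt0P=> j Avj Rjw; exists (enum_val j); rewrite enum_valK Rjw andbT.
by apply/adjacency_reachP; exists n; rewrite enum_valK.
Qed.

End Crossing.

(** * Linked vertices and linked cycles *)

Section ShiftEquivalence.
Variables (E F : fin_graph) (l : nat).
Variables (R : 'M[nat]_(#|vert E|, #|vert F|)) (S : 'M[nat]_(#|vert F|, #|vert E|)).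
Local Notation A := (adjacency E).
Local Notation B := (adjacency F).
Hypothesis l_gt0 : 0 < l.
Hypothesis RS : (A ^+ l = R *m S)%R.
Hypothesis SR : (B ^+ l = S *m R)%R.
Hypothesis AR : (A *m R = R *m B)%R.

Lemma crosses_reach v w w' : crosses R v w -> reach w w' -> crosses R v w'.
Proof.
case/crossesP=> n Avw /adjacency_reachP[m Bww']; apply/crossesP; exists (n + m).
rewrite exprD -mulmxE -mulmxA (mulmx_exp_comm _ AR) mulmxA.
by apply/mulmx_gt0P; exists (enum_rank w).
Qed.

Lemma reach_crosses v v' w : reach v v' -> crosses R v' w -> crosses R v w.
Proof.
move=> vv' /existsP[u /andP[v'u Ruw]]; apply/existsP; exists u.
by rewrite Ruw andbT; apply: connect_trans v'u.
Qed.

(** The steps in [F] are first moved to [E]; then the crossings by [R] and [S] amount to [l] steps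
    in [E], as [R S = A^l]. *)
Lemma crosses_back v w v' : crosses R v w -> crosses S w v' -> reach v v'.
Proof.
move=> vw /existsP[u /andP[wu Suv']].
have /crossesP[n Avu] := crosses_reach vw wu.
apply/adjacency_reachP; exists (n + l); rewrite exprD -mulmxE RS mulmxA.
by apply/mulmx_gt0P; exists (enum_rank u).
Qed.

(** This is membership in one strongly connected component once [R] and [S] are added as edges
    between the graphs. *)
Definition linked v w := crosses R v w && crosses S w v.

(* A closed path of length [N >= l] at [v] is counted by [R B^(N - l) S], whose
   nonzero summands close up to paths of length [N] in [F] since [S R = B^l]. *)
Lemma linked_closed_path v p :
  path_from_to v p v -> l <= size p ->
  exists w q, [/\ linked v w, path_from_to w q w & size q = size p].
Proof.
move=> pv lelp; have Dp := subnK lelp.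
have: 0 < (A ^+ (size p))%R (enum_rank v) (enum_rank v).
  by apply/adjacency_exp_gt0; exists p; rewrite ?enum_rankK.
rewrite -Dp exprD -mulmxE RS mulmxA (mulmx_exp_comm _ AR).
case/mulmx_gt0P=> k /mulmx_gt0P[j Rvj Bjk] Skv.
have: 0 < (B ^+ (size p))%R j j.
  rewrite -Dp exprD -mulmxE SR; apply/mulmx_gt0P; exists k => //.
  by apply/mulmx_gt0P; exists (enum_rank v).
case/adjacency_exp_gt0=> q Dq qj; exists (enum_val j), q; split=> //; last by rewrite Dq Dp.
rewrite /linked; apply/andP; split.
  by apply/existsP; exists v; rewrite enum_valK Rvj [reach _ _]connect0.
apply/existsP; exists (enum_val k); rewrite enum_valK Skv andbT.
by apply/adjacency_reachP; exists (size p - l); rewrite !enum_valK.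
Qed.

Definition class_linked (c : cycle_class E) (d : cycle_class F) :=
  [exists v, exists w, [&& v \in cycle_verts c, w \in cycle_verts d & linked v w]].

Lemma class_linkedP (c : cycle_class E) (d : cycle_class F) :
  reflect (exists v w, [/\ v \in cycle_verts c, w \in cycle_verts d & linked v w])
          (class_linked c d).
Proof.
apply: (iffP existsP) => [[v /existsP[w /and3P vw]]|[v [w /and3P vw]]]; exists v.
  by exists w.
by apply/existsP; exists w.
Qed.

Lemma class_linked_ex (c : cycle_class E) : exists d, class_linked c d.
Proof.
have [v cv] := cycle_class_vert c; have [p [/and3P[p_gt0 pv _] _ _]] := cycle_class_closed cv.
(* Going [l] times around [c] reaches the length [l] that [linked_closed_path] requires. *)
have szf : size (flatten (nseq l p)) = size p * l.
  by rewrite size_flatten /shape map_nseq sumn_nseq.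
have [|w [q [vw qw Dq]]] := linked_closed_path (path_from_to_flatten l pv).
  by rewrite szf leq_pmull.
have [|d dw] := closed_path_class _ qw; first by rewrite Dq szf muln_gt0 p_gt0.
by exists d; apply/class_linkedP; exists v, w.
Qed.

End ShiftEquivalence.

(** * Traces and the invariance of disjointness *)

Lemma shift_equivalent_sym (m n : nat) (A : 'M[nat]_m) (B : 'M[nat]_n) :
  shift_equivalent A B -> shift_equivalent B A.
Proof. by case=> l [R [S [l_gt0 [RS SR] AR SA]]]; exists l, S, R; split. Qed.

(** [A^(m+l) = R B^m S] and [B^(m+l) = B^m S R] have the same trace by cyclicity. *)
Lemma shift_equivalent_trace (m n : nat) (A : 'M[nat]_m) (B : 'M[nat]_n) :
  shift_equivalent A B ->
  exists l, forall k, l <= k -> (\tr (A ^+ k) = \tr (B ^+ k))%R.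
Proof.
case=> l [R [S [_ [RS SR] AR _]]]; exists l => k /subnK<-.
by rewrite !exprD -!mulmxE RS SR mulmxA (mulmx_exp_comm _ AR) -mulmxA mxtrace_mulC -mulmxA.
Qed.

Lemma disjoint_cycles_shift (E F : fin_graph) :
  shift_equivalent (adjacency E) (adjacency F) -> disjoint_cycles E -> disjoint_cycles F.
Proof.
case/shift_equivalent_trace=> l trEF /disjoint_diag_le1 diagE; apply/disjoint_diag_le1.
apply: (@diag_le1_of_bounded_trace _ _ l #|vert E|) => k /trEF <-.
apply: (@leq_trans (\sum_(i < #|vert E|) 1)); last by rewrite sum1_card card_ord.
by apply: leq_sum.
Qed.

(** * The matching of cycle classes *)

Section Bijection.
Variables (E F : fin_graph) (l : nat).
Variables (R : 'M[nat]_(#|vert E|, #|vert F|)) (S : 'M[nat]_(#|vert F|, #|vert E|)).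
Local Notation A := (adjacency E).
Local Notation B := (adjacency F).
Hypothesis l_gt0 : 0 < l.
Hypothesis RS : (A ^+ l = R *m S)%R.
Hypothesis SR : (B ^+ l = S *m R)%R.
Hypothesis AR : (A *m R = R *m B)%R.
Hypothesis SA : (S *m A = B *m S)%R.

Lemma class_linked_sym (c : cycle_class E) (d : cycle_class F) :
  class_linked S R d c = class_linked R S c d.
Proof.
by apply/class_linkedP/class_linkedP => -[v [w [? ? /andP[? ?]]]];
  exists w, v; split=> //; apply/andP.
Qed.

(** The required path in [F] follows the round trip from [w'] over [v'] and [v] to [w]. *)
Lemma class_linked_le (c c' : cycle_class E) (d d' : cycle_class F) :
  class_linked R S c d -> class_linked R S c' d' -> cycle_le c c' -> cycle_le d d'.
Proof.
case/class_linkedP=> v [w [cv dw /andP[vw wv]]].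
case/class_linkedP=> v' [w' [cv' dw' /andP[vw' wv']]].
move/(cycle_leP cv cv') => v'v; apply/(cycle_leP dw dw').
apply: (crosses_back SR (esym SA)) wv' _.
exact: reach_crosses v'v vw.
Qed.

(** Applying [class_linked_le] to [c] below itself, in both orders, makes [d] and [d'] mutually
    reachable. *)
Lemma class_linked_inj (c : cycle_class E) (d d' : cycle_class F) :
    disjoint_cycles F ->
  class_linked R S c d -> class_linked R S c d' -> d = d'.
Proof.
move=> disjF cd cd'; have [v cv] := cycle_class_vert c.
have cc : cycle_le c c by apply/(cycle_leP cv cv)/connect0.
have [[w dw] [w' dw']] := (cycle_class_vert d, cycle_class_vert d').
apply: (reach_cycle_class disjF dw dw').
  by apply/(cycle_leP dw' dw); apply: class_linked_le cd' cd cc.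
by apply/(cycle_leP dw dw'); apply: class_linked_le cd cd' cc.
Qed.

Lemma class_linked_length_dvd (c : cycle_class E) (d : cycle_class F) :
    disjoint_cycles F ->
  class_linked R S c d -> cycle_length d %| cycle_length c.
Proof.
move=> disjF cd; have [v cv] := cycle_class_vert c.
have [p [/and3P[p_gt0 pv _] <- _]] := cycle_class_closed cv.
(* Going [k] times around [c] yields a closed path of the same length in [F]. It starts on a class
   linked to [c], which is [d] by injectivity. *)
have dvd_mul k : l <= k -> cycle_length d %| k * size p.
  move=> lek; have szf : size (flatten (nseq k p)) = k * size p.
    by rewrite size_flatten /shape map_nseq sumn_nseq mulnC.
  have [|w [q [vw qw Dq]]] := linked_closed_path RS SR AR (path_from_to_flatten k pv).
    by rewrite szf (leq_trans lek) // leq_pmulr.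
  have [|d' dw] := closed_path_class _ qw.
    by rewrite Dq szf muln_gt0 p_gt0 (leq_trans l_gt0).
  have cd' : class_linked R S c d' by apply/class_linkedP; exists v, w.
  rewrite -szf -Dq (class_linked_inj disjF cd cd').
have [p' [cp' <- _]] := cycle_class_closed dw; exact: (cycle_dvd_closed disjF cp' qw).
(* The multiples for [l + 1] and [l] differ by exactly [size p]. *)
by have := dvd_mul _ (leqnSn l); rewrite mulSn dvdn_addl // dvd_mul.
Qed.

End Bijection.

Theorem theorem3p2 (E F : fin_graph) (hE : essential E) (hF : essential F)
    (hEF : shift_equivalent (adjacency E) (adjacency F)) :
  (disjoint_cycles E <-> disjoint_cycles F) /\
  (disjoint_cycles E ->
   exists phi : cycle_class E -> cycle_class F,
     [/\ bijective phi,
         (forall c c' : cycle_class E, cycle_le c c' -> cycle_le (phi c) (phi c')) &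
         (forall c : cycle_class E, cycle_length c = cycle_length (phi c))]).
Proof.
have disjEF := disjoint_cycles_shift hEF.
split; first by split=> //; apply: disjoint_cycles_shift (shift_equivalent_sym hEF).
move=> disjE; have disjF := disjEF disjE.
have [l [R [S [l_gt0 [RS SR] AR SA]]]] := hEF.
have exF := class_linked_ex l_gt0 RS SR AR.
have exE := class_linked_ex l_gt0 SR RS (esym SA).
pose phi c := xchoose (exF c); pose psi d := xchoose (exE d).
have phiP c : class_linked R S c (phi c) by apply: xchooseP.
have psiP d : class_linked R S (psi d) d by rewrite -class_linked_sym; apply: xchooseP.
exists phi; split=> [|c c'|c].
(* Both [phi] and [psi] choose linked partners, so uniqueness of partners on each side makes them
   mutually inverse. *)
- exists psi => [c|d]; last exact: (class_linked_inj SR SA disjF (phiP _) (psiP _)).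
  by apply: (class_linked_inj RS (esym AR) disjE); rewrite class_linked_sym; [apply: psiP | apply: phiP].
- exact: (class_linked_le SR SA).
apply/eqP; rewrite eqn_dvd; apply/andP; split.
  by apply: (class_linked_length_dvd l_gt0 SR RS (esym SA) (esym AR) disjE); rewrite class_linked_sym.
exact: (class_linked_length_dvd l_gt0 RS SR AR SA disjF).
Qed.
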